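(* Let $T>0$, $k>0$, $\rho_1<\rho_2$, and let $u\in\mathrm{L}^2(0,T)$. Then for each $\xi\in[-1,1]$ there exists a unique function $y\in\mathrm{H}^1(0,T)$ satisfying $$\frac{dy}{dt}(t)+\partial\chi_{[-1,1]}(y(t))\ni g_\rho(u(t))\ \text{ for a.e. }t\in(0,T),\qquad y(0)=\xi .$$ Consequently, the function $q$ defined almost everywhere by $$q(t):=-\frac{dy}{dt}(t)-k(u(t)-\rho_1)^-+k(u(t)-\rho_2)^+$$ belongs to $\mathrm{L}^2(0,T)$ and $q(t)\in\partial\chi_{[-1,1]}(y(t))$ a.e. in $(0,T)$.
   Context: Notation: $x^+=\max\{x,0\}$, $x^-=\max\{-x,0\}$; for $\rho=(\rho_1,\rho_2)$, $g_\rho(s)=-k(s-\rho_1)^-+k(s-\rho_2)^+$. $\partial\chi_{[-1,1]}$ denotes the subdifferential of the indicator function of $[-1,1]$: $\partial\chi_{[-1,1]}(x)$ equals $[0,\infty)$ if $x=1$, $(-\infty,0]$ if $x=-1$, $\{0\}$ if $|x|<1$, and $\emptyset$ if $|x|>1$ (so that a solution automatically satisfies $|y|\le1$). *)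

(* Defs.v *)
From HB Require Import structures.
From mathcomp Require Import all_boot all_order all_algebra.
From mathcomp Require Import all_classical all_reals all_analysis.
From mathcomp Require Import lra.
Set Implicit Arguments.
Unset Strict Implicit.
Unset Printing Implicit Defensive.
Import Order.TTheory GRing.Theory Num.Theory.
Import numFieldNormedType.Exports.
Local Open Scope classical_set_scope.
Local Open Scope ring_scope.

Definition pos_part (R : realType) (x : R) : R := Num.max x 0.
Definition neg_part (R : realType) (x : R) : R := Num.max (- x) 0.

Definition g_rho (R : realType) (k rho1 rho2 s : R) : R :=
  - k * neg_part (s - rho1) + k * pos_part (s - rho2).

(* The indicator function of convex analysis: 0 on C and +oo off C. *)
Definition indicator (R : realType) (C : set R) (x : R) : \bar R :=
  if x \in C then 0%E else +oo%E.

(* Where f x = +oo this is empty as soon as f is finite somewhere. *)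
Definition subdifferential (R : realType) (f : R -> \bar R) (x : R) : set R :=
  [set p | forall z : R, (f x + (p * (z - x))%:E <= f z)%E].

Definition subdiff_ind (R : realType) : R -> set R :=
  subdifferential (indicator `[-1, 1]).

Lemma subdiff_indE (R : realType) (x : R) :
  [/\ x = 1 -> subdiff_ind x = [set p | 0 <= p],
      x = -1 -> subdiff_ind x = [set p | p <= 0],
      `|x| < 1 -> subdiff_ind x = [set 0] &
      1 < `|x| -> subdiff_ind x = set0].
Proof.
have indP z : indicator (R:=R) `[-1, 1] z =
    if (-1 <= z <= 1) then 0%E else +oo%E.
  by rewrite /indicator mem_setE in_itv.
have sP p : -1 <= x <= 1 -> subdiff_ind x p <->
    forall z, -1 <= z <= 1 -> p * (z - x) <= 0.
  move=> x1; split=> [+ z z1|H z].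
    by move=> /(_ z); rewrite !indP x1 z1 add0e lee_fin.
  by rewrite !indP x1 add0e; case: ifPn => [/H|_]; rewrite ?lee_fin ?leey.
split=> [x1|x1|x1|x1]; apply/seteqP; split=> p /=.
- move/sP; rewrite x1 => /(_ _ 0) H; have := H ltac:(lra) ltac:(lra); lra.
- move=> p0; apply/sP; first by lra.
  by move=> z; rewrite x1 => z1; nra.
- move/sP; rewrite x1 => /(_ _ 0) H; have := H ltac:(lra) ltac:(lra); lra.
- move=> p0; apply/sP; first by lra.
  by move=> z; rewrite x1 => z1; nra.
- move: x1; rewrite ltr_norml => x1 /sP H.
  have {}H z : -1 <= z <= 1 -> p * (z - x) <= 0 by apply: H; lra.
  by have := H 1 ltac:(lra); have := H (-1) ltac:(lra); nra.
- move=> ->; move: x1; rewrite ltr_norml => x1.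
  by apply/sP => [|z _]; [lra|rewrite mul0r].
- move=> /(_ 0); rewrite !indP.
  have -> : (-1 <= x <= 1) = false by rewrite -ler_norml leNgt x1.
  by rewrite lerN10 ler01.
- by [].
Qed.

(* Only the values of f on (0, T) matter: f is extended by zero outside. *)
Definition L2 (R : realType) (T : R) (f : R -> R) : Prop :=
  f \_ `]0, T[ \in Lfun (@lebesgue_measure R) 2%:E.

Definition test_function (R : realType) (T : R) (phi : R -> R) : Prop :=
  [/\ forall (n : nat) (x : R), derivable (derive1n n phi) x 1,
      compact (closure [set x | phi x != 0]) &
      closure [set x | phi x != 0] `<=` `]0, T[ ].

Definition is_weak_derivative (R : realType) (T : R) (y v : R -> R) : Prop :=
  forall phi : R -> R, test_function T phi ->
    \int[@lebesgue_measure R]_(t in `]0, T[) (y t * derive1 phi t) =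
    - \int[@lebesgue_measure R]_(t in `]0, T[) (v t * phi t).

(* An element of H^1(0, T) is represented by its unique representative that is
   continuous on [0, T], so that y 0 is the trace of y at 0. *)
Definition H1 (R : realType) (T : R) (y : R -> R) : Prop :=
  [/\ L2 T y, {within `[0, T], continuous y} &
      exists2 v : R -> R, L2 T v & is_weak_derivative T y v].

(* A representative of dy/dt, which is determined almost everywhere on (0, T);
   meaningful for y in H^1(0, T). *)
Definition ddt (R : realType) (T : R) (y : R -> R) : R -> R :=
  xget (fun=> 0) [set v : R -> R | L2 T v /\ is_weak_derivative T y v].

Definition solution (R : realType) (T k rho1 rho2 : R) (u : R -> R) (xi : R)
    (y : R -> R) : Prop :=
  [/\ H1 T y,
      {ae @lebesgue_measure R, forall t, 0 < t < T ->
        [set ddt T y t + p | p in subdiff_ind (y t)]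
          (g_rho k rho1 rho2 (u t))} &
      y 0 = xi].

(* Main.v *)
(* Existence: with F(t) = xi + int_0^t g_rho(u), the solution is y = F - zeta,
   where zeta is the play of F with thresholds F - 1 and F + 1, given by an
   explicit supremum formula.  The increments of zeta are bounded by the
   integrals of |g_rho(u)|, so that zeta is the primitive of some w
   (Radon-Nikodym).  At almost every t, w(t) is the derivative of zeta at t;
   since zeta is nondecreasing near t if y(t) > -1 and nonincreasing near t if
   y(t) < 1, w(t) lies in the subdifferential at y(t).
   Uniqueness: by monotonicity of the subdifferential, z - y cannot increase on
   an interval where z > y.  To read this off weak derivatives, these are tested
   against smooth approximations of indicator functions of intervals. *)
Require Import Defs.
From HB Require Import structures.
From mathcomp Require Import all_boot all_order all_algebra.
From mathcomp Require Import all_classical all_reals all_analysis.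
From mathcomp Require Import measurable_realfun ring lra.
Set Implicit Arguments.
Unset Strict Implicit.
Unset Printing Implicit Defensive.
Import Order.TTheory GRing.Theory Num.Theory.
Import numFieldNormedType.Exports.
Local Open Scope classical_set_scope.
Local Open Scope ring_scope.

(** In the language of hysteresis, [y] is the stop and [zeta] the play with input [F]: since
    [F' = g_rho(u)] a.e., the inclusion says that [zeta' = g_rho(u) - y'] lies in the
    subdifferential at [y], and [|y| <= 1] reads [F - 1 <= zeta <= F + 1]. The supremum formula
    replaces a limit of time-discrete or penalised problems; only its comparison bounds are used.
    They control [zeta] through increments alone, whereas a solution needs a weak derivative in L2.
    Radon-Nikodym yields only an integrable density [w]; differentiating the increment bound at
    almost every point then gives [|w| <= |g_rho(u)|], hence [w] in L2. As [ddt] is an unspecified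
    choice among weak derivatives, both halves rest on recovering increments from a weak derivative:
    existence, to exchange [ddt] for the constructed derivative; uniqueness, to compare two
    solutions. Comparing where [z > y], rather than estimating the square of [z - y], avoids a
    product rule for weak derivatives. *)

(** * Smooth step functions built from [exp(-1/x)] *)

Section smooth_functions.
Context {R : realType}.
Implicit Types (f g : R -> R) (x : R).

(** Each level carries a derivative as a witness instead of referring to [derive1n], so that closure
    under products and inverses goes by induction on [n] without any formula for higher
    derivatives. *)
Fixpoint times_differentiable (n : nat) f : Prop :=
  if n is n'.+1 then
    exists2 g : R -> R, (forall x, is_derive x 1 f (g x)) & times_differentiable n' g
  else True.

Lemma times_differentiable_derivable n f :
  times_differentiable n.+1 f -> forall x, derivable (derive1n n f) x 1.
Proof.
elim: n f => [f [g fg _] x|n IHn f [g fg gn] x].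
  by have [] := fg x.
rewrite derive1Sn (_ : derive1 f = g); first exact: IHn.
by apply/funext => y; rewrite derive1E; have [_ ->] := fg y.
Qed.

Lemma times_differentiableW n f :
  times_differentiable n.+1 f -> times_differentiable n f.
Proof. by elim: n f => // n IHn f [g fg gn]; exists g => //; exact: IHn. Qed.

Lemma times_differentiableD n f g : times_differentiable n f ->
  times_differentiable n g -> times_differentiable n (fun x => f x + g x).
Proof.
elim: n f g => // n IHn f g [f' ff' f'n] [g' gg' g'n].
by exists (fun x => f' x + g' x); [move=> x; exact: is_deriveD|exact: IHn].
Qed.

Lemma times_differentiableZ n a f : times_differentiable n f ->
  times_differentiable n (fun x => a * f x).
Proof.
elim: n f => // n IHn f [f' ff' f'n].
by exists (fun x => a * f' x); [move=> x; exact: is_deriveZ|exact: IHn].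
Qed.

Lemma times_differentiableM n f g : times_differentiable n f ->
  times_differentiable n g -> times_differentiable n (fun x => f x * g x).
Proof.
elim: n f g => // n IHn f g fn gn.
have [f' ff' f'n] := fn; have [g' gg' g'n] := gn.
exists (fun x => f x * g' x + g x * f' x); first by move=> x; exact: is_deriveM.
by apply: times_differentiableD; apply: IHn => //; exact: times_differentiableW.
Qed.

(** The derivative of [1/f] is [-(1/f)^2 f'], which involves [1/f] only to the order covered by the
    induction hypothesis. *)
Lemma times_differentiableV n f : (forall x, f x != 0) ->
  times_differentiable n f -> times_differentiable n (fun x => (f x)^-1).
Proof.
move=> f0; elim: n => // n IHn fn; have [f' ff' f'n] := fn.
exists (fun x => - 1 * ((f x)^-1 * (f x)^-1) * f' x).
  move=> x; apply: is_derive_eq (is_deriveV (f0 x) (ff' x)) _.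
  by rewrite /GRing.scale/= mulN1r expr2 invfM.
apply: (times_differentiableM _ f'n); apply: times_differentiableZ.
by have Vn := IHn (times_differentiableW fn); exact: times_differentiableM.
Qed.

Lemma times_differentiable_affine n a b f : times_differentiable n f ->
  times_differentiable n (fun x => f (a * x + b)).
Proof.
elim: n f => // n IHn f [f' ff' f'n]; exists (fun x => a * f' (a * x + b)).
  move=> x; rewrite mulrC; apply: (@is_derive1_comp _ f (fun x => a * x + b)).
  by apply: is_derive_eq; rewrite addr0 /GRing.scale/= mulr1.
by apply: times_differentiableZ; exact: IHn.
Qed.

(** [flat 0] is the classical [exp(-1/x)]. With the powers [x^-m] included, differentiation stays
    within linear combinations of the family, which makes smoothness an induction with [m] free. *)
Definition flat m x : R := if 0 < x then x ^- m * expR (- x^-1) else 0.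

Lemma flat_ge0 m x : 0 <= flat m x.
Proof.
rewrite /flat; case: ifPn => // x0.
by rewrite mulr_ge0 ?expR_ge0// invr_ge0 exprn_ge0// ltW.
Qed.

Lemma flat_le0 m x : x <= 0 -> flat m x = 0.
Proof. by rewrite /flat leNgt => /negbTE ->. Qed.

Lemma flat_gt0 m x : 0 < x -> 0 < flat m x.
Proof. by move=> x0; rewrite /flat x0 mulr_gt0 ?expR_gt0// invr_gt0 exprn_gt0. Qed.

(** A single term of the exponential series at [1/x] suffices. The bound serves to make the
    difference quotient at 0 vanish. *)
Lemma flat_le_linear m x : 0 < x -> flat m x <= m.+1`!%:R * x.
Proof.
move=> x0; rewrite /flat x0 expRN.
have xV : 0 <= x^-1 by rewrite invr_ge0 ltW.
have : x ^- m.+1 / m.+1`!%:R <= expR x^-1.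
  by refine (le_trans _ (expR_ge1Dxn m xV)); rewrite exprVn lerDr ler01.
have fp : 0 < (m.+1)`!%:R :> R by rewrite ltr0n fact_gt0.
rewrite ler_pdivrMr// exprS => h.
rewrite ler_pdivrMr ?expR_gt0//.
rewrite -mulrA mulrC -mulrA -ler_pdivrMl// mulrC.
by rewrite -invfM [leRHS]mulrC.
Qed.

Lemma is_derive_flat m x :
  is_derive x 1 (flat m) (- m%:R * flat m.+1 x + flat m.+2 x).
Proof.
have [x0|x0|->] := ltgtP x 0.
- rewrite !flat_le0 ?ltW// mulr0 addr0.
  apply: (@near_eq_is_derive _ _ _ (cst 0)).
  near=> y; rewrite flat_le0//= ltW//.
  by near: y; exact: lt_nbhsl.
- have xn0 : x != 0 by rewrite gt_eqF.
  have dV : is_derive x 1 (fun y : R => y^-1) (- x ^- 2).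
    apply: is_derive_eq (is_deriveV xn0 (is_derive_id x 1)) _.
    by rewrite /GRing.scale/= mulr1.
  have dX := is_deriveX m dV.
  have dE : is_derive x 1 (fun y : R => expR (- y^-1)) (expR (- x^-1) * x ^- 2).
    apply: (@is_derive1_comp _ expR (fun y : R => - y^-1)).
    by apply: is_derive_eq; rewrite opprK.
  apply: near_eq_is_derive (is_derive_eq (is_deriveM dX dE) _).
    near=> y; rewrite /flat ifT; last by near: y; exact: lt_nbhsr.
    by rewrite -exprVn /= !fctE.
  rewrite /flat x0 /GRing.scale/= exprfctE.
  case: m {dX} => [|m]; first by rewrite mulr0n; field.
  by rewrite /= -!exprVn !exprS; ring.
- rewrite !flat_le0// mulr0 addr0.
  suff h : (fun h => h^-1 *: ((flat m \o shift 0) (h *: 1) - flat m 0)) @ 0^' --> (0:R).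
    by apply: DeriveDef; [apply/cvg_ex; exists 0|exact/cvg_lim].
  apply/cvgr0Pnorm_le => e e0; near=> h.
  rewrite /= /GRing.scale/= mulr1 addr0 (flat_le0 m (lexx 0)) subr0.
  have [h0|h0] := leP h 0; first by rewrite flat_le0// mulr0 normr0 ltW.
  (* Dividing by [h] raises the index by one, so the linear bound applies to the quotient itself. *)
  have -> : h^-1 * flat m h = flat m.+1 h.
    by rewrite /flat h0 exprS invfM mulrA.
  rewrite ger0_norm ?flat_ge0// (le_trans (flat_le_linear m.+1 h0))//.
  rewrite mulrC -ler_pdivlMr ?ltr0n ?fact_gt0//.
  have : `|h| <= e / m.+2`!%:R.
    near: h; apply: dnbhs0_le.
    by rewrite divr_gt0// ltr0n fact_gt0.
  by rewrite gtr0_norm.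
Unshelve. all: by end_near. Qed.

Lemma times_differentiable_flat n m : times_differentiable n (flat m).
Proof.
elim: n m => // n IHn m; exists (fun x => - m%:R * flat m.+1 x + flat m.+2 x).
  exact: is_derive_flat.
by apply: times_differentiableD => //; exact: times_differentiableZ.
Qed.

(** The form [- 1 * x + 1] of [1 - x] fits [times_differentiable_affine]. *)
Definition smooth_step x := flat 0 x * (flat 0 x + flat 0 (- 1 * x + 1))^-1.

Let denom_gt0 x : 0 < flat 0 x + flat 0 (- 1 * x + 1).
Proof.
have [x0|x0] := leP x 0; first by rewrite ltr_wpDl ?flat_ge0// flat_gt0//; lra.
by rewrite ltr_pwDl ?flat_ge0// flat_gt0.
Qed.

Lemma times_differentiable_smooth_step n : times_differentiable n smooth_step.
Proof.
apply: times_differentiableM; first exact: times_differentiable_flat.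
apply: times_differentiableV; first by move=> x; rewrite gt_eqF.
apply: times_differentiableD; first exact: times_differentiable_flat.
exact/times_differentiable_affine/times_differentiable_flat.
Qed.

Lemma smooth_step_le0 x : x <= 0 -> smooth_step x = 0.
Proof. by move=> x0; rewrite /smooth_step flat_le0// mul0r. Qed.

Lemma smooth_step_ge1 x : 1 <= x -> smooth_step x = 1.
Proof.
move=> x1; rewrite /smooth_step (@flat_le0 0 (_ + _)); last lra.
by rewrite addr0 mulfV// gt_eqF// flat_gt0//; lra.
Qed.

Lemma smooth_step_itv x : 0 <= smooth_step x <= 1.
Proof.
apply/andP; split; first by rewrite mulr_ge0 ?flat_ge0 ?invr_ge0 ?ltW.
by rewrite ler_pdivrMr// mul1r lerDl flat_ge0.
Qed.

(** By the quotient rule the numerator is [f(1-x) f'(x) + f(x) f'(1-x)] with [f = flat 0] and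
    [f' = flat 2], both nonnegative. The sign turns derivatives of rescaled steps into averaging
    kernels. *)
Lemma smooth_step_derive1_ge0 x : 0 <= derive1 smooth_step x.
Proof.
rewrite derive1E.
set g := fun x => flat 0 x + flat 0 (- 1 * x + 1).
have dg : is_derive x 1 g (flat 2 x - flat 2 (- 1 * x + 1)).
  apply: is_deriveD.
    by apply: is_derive_eq; [exact: is_derive_flat|rewrite oppr0 mul0r add0r].
  apply: (@is_derive_eq _ _ _ _ _ _ _ (flat 2 (- 1 * x + 1) * - 1)).
    apply: (@is_derive1_comp _ (flat 0) (fun x => - 1 * x + 1)).
      by apply: is_derive_eq; [exact: is_derive_flat|rewrite oppr0 mul0r add0r].
    by apply: is_derive_eq; rewrite addr0 /GRing.scale/= mulr1.
  by rewrite mulrN1.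
have g0 : g x != 0 by rewrite gt_eqF// denom_gt0.
have d : is_derive x 1 smooth_step _ :=
  is_deriveM (is_derive_flat 0 x) (is_deriveV g0 dg).
have [_ ->] := d.
rewrite oppr0 mul0r add0r /GRing.scale/=.
rewrite (_ : _ + _ = (flat 0 (- 1 * x + 1) * flat 2 x +
  flat 0 x * flat 2 (- 1 * x + 1)) / g x ^+ 2).
  apply: divr_ge0; last exact: sqr_ge0.
  by apply: addr_ge0; apply: mulr_ge0; exact: flat_ge0.
by move: g0; rewrite /g => g0; field.
Qed.
End smooth_functions.

(** * Square-integrable functions on the bounded interval *)

Section L2_space.
Context {R : realType}.
Notation mu := (@lebesgue_measure R).
Implicit Types (T : R) (f g : R -> R).

Lemma Lfun2_dominated d (X : measurableType d) (nu : {measure set X -> \bar R})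
    (f g : X -> R) : measurable_fun setT f ->
  {ae nu, forall x, `|f x| <= `|g x|} ->
  g \in Lfun nu 2%:E -> f \in Lfun nu 2%:E.
Proof.
move=> mf fg gL2; have mg : measurable_fun setT g.
  by move: gL2; rewrite inE => /andP[/[!inE]].
have := Lfun_integrable (ler1n _ 2) gL2.
move=> /integrableP[_ ig].
apply/andP; split; rewrite inE//= /finite_norm unlock poweR_lty//.
have mpow (h : X -> R) : measurable_fun setT h ->
    measurable_fun setT (fun x => (`|h x| `^ 2)%:E).
  move=> mh; apply/measurable_EFinP.
  apply: (@measurableT_comp _ _ _ _ _ _ (fun x : R => x `^ 2)) => //.
  exact: measurableT_comp.
apply: le_lt_trans ig; apply: ae_ge0_le_integral => //.
- by move=> x _; exact: poweR_ge0.
- exact: mpow.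
- by apply: measurableT_comp => //; exact: mpow.
- apply: filterS fg => x fgx _; rewrite /= lee_fin [leRHS]ger0_norm ?powR_ge0//.
  exact: ge0_ler_powR.
Qed.

Lemma Lfun2_indic T : \1_`]0, T[ \in Lfun mu 2%:E.
Proof.
apply/andP; split; rewrite inE/=; first exact: measurable_indic.
rewrite /finite_norm unlock poweR_lty//.
under eq_integral.
  move=> x _; rewrite /= (_ : _ `^ _ = \1_`]0, T[ x); last first.
    rewrite ger0_norm//= indicE; case: (_ \in _); first by rewrite powR1.
    by rewrite powR0// pnatr_eq0.
  over.
rewrite integral_indic//= setIT.
by have := @lebesgue_measure_itv R `]0, T[; rewrite /= => ->; case: ifP; rewrite ?ltry.
Qed.

Lemma L2_measurable T f : L2 T f -> measurable_fun setT (f \_ `]0, T[).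
Proof. by rewrite /L2 inE => /andP[/[!inE]]. Qed.

(** Cauchy-Schwarz against the indicator of []0, T[], which is square integrable as the interval is
    bounded. *)
Lemma L2_integrable T f : L2 T f -> mu.-integrable setT (EFin \o f \_ `]0, T[).
Proof.
move=> fL2; apply/Lfun1_integrable.
have := Lfun2_mul_Lfun1 fL2 (Lfun2_indic T).
rewrite (_ : _ \* _ = f \_ `]0, T[)//; apply/funext => x.
by rewrite /= patchE indicE; case: (_ \in _); rewrite ?mulr1 ?mulr0.
Qed.

Lemma Lfun2_linear (a : R) f g : f \in Lfun mu 2%:E -> g \in Lfun mu 2%:E ->
  a *: f + g \in Lfun mu 2%:E.
Proof. exact: (Lfun_submod_closed mu (lee1n 2)).2. Qed.

Lemma L2B T f g : L2 T f -> L2 T g -> L2 T (fun x => f x - g x).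
Proof.
move=> fL2 gL2; rewrite /L2 (_ : _ \_ _ = -1 *: (g \_ `]0, T[) + f \_ `]0, T[).
  exact: Lfun2_linear.
apply/funext => x; rewrite fctE scalrfctE !patchE scaleN1r.
by case: ifP => _; rewrite addrC// subr0.
Qed.

Lemma measurable_g_rho (k r1 r2 : R) : measurable_fun setT (g_rho k r1 r2).
Proof.
apply: measurable_funD; apply: measurable_funM => //; apply: measurable_maxr => //.
- by apply: measurable_funN; exact: measurable_funB.
- exact: measurable_funB.
Qed.

Lemma norm_g_rho_le (k r1 r2 x : R) :
  `|g_rho k r1 r2 x| <= 2 * `|k| * `|x| + `|k| * (`|r1| + `|r2|).
Proof.
have ppart (y : R) : `|pos_part y| <= `|y|.
  by rewrite /pos_part; case: (leP y 0) => // y0; rewrite normr0.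
have npart (y : R) : `|neg_part y| <= `|y| by have := ppart (- y); rewrite normrN.
rewrite /g_rho (le_trans (ler_normD _ _))// !normrM normrN.
rewrite [leRHS](_ : _ = `|k| * (`|x| + `|r1|) + `|k| * (`|x| + `|r2|)); last by ring.
apply: lerD; apply: ler_wpM2l => //.
- exact: le_trans (npart _) (ler_normB _ _).
- exact: le_trans (ppart _) (ler_normB _ _).
Qed.

Lemma L2_g_rho T (k r1 r2 : R) u : L2 T u -> L2 T (g_rho k r1 r2 \o u).
Proof.
move=> uL2.
pose c := `|k| * (`|r1| + `|r2|).
pose h : R -> R :=
  2 * `|k| *: (Num.norm \o u \_ `]0, T[) + c *: (\1_`]0, T[ : R -> R).
have hL2 : h \in Lfun mu 2%:E.
  have cL2 : c *: (\1_`]0, T[ : R -> R) \in Lfun mu 2%:E.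
    rewrite -[_ *: _]addr0; apply: Lfun2_linear; first exact: Lfun2_indic.
    exact: (Lfun_submod_closed mu (lee1n 2)).1.
  apply: Lfun2_linear => //; apply: (Lfun2_dominated _ _ uL2); last first.
    by apply: aeW => x; rewrite [leLHS]normr_id lexx.
  by apply: measurableT_comp => //; exact: L2_measurable.
apply: (Lfun2_dominated _ _ hL2).
- rewrite (_ : _ \_ _ = (g_rho k r1 r2 \o u \_ `]0, T[) \* \1_`]0, T[).
    apply: measurable_funM; last exact: measurable_indic.
    apply: measurableT_comp; last exact: L2_measurable.
    exact: measurable_g_rho.
  apply/funext => x; rewrite /= !patchE indicE.
  by case: (_ \in _); rewrite ?mulr1// mulr0.
- apply: aeW => x; rewrite /h !fctE/= !patchE indicE; case: (x \in _); last first.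
    by rewrite normr0.
  rewrite /GRing.scale/= mulr1 [leRHS]ger0_norm ?norm_g_rho_le//.
  by rewrite /c addr_ge0 ?mulr_ge0 ?addr_ge0.
Qed.
End L2_space.

(** * Primitives, and functions with dominated increments *)

Section primitives.
Context {R : realType}.
Notation mu := (@lebesgue_measure R).
Implicit Types (f h z : R -> R) (s t : R).

(** With base point -oo, the increments of a globally integrable [f] are integrals over []s, t]]
    whatever the signs of [s] and [t]. *)
Definition primitive f t : R := \int[mu]_(x in `]-oo, t]) f x.

Lemma primitiveB f s t : mu.-integrable setT (EFin \o f) -> s <= t ->
  primitive f t - primitive f s = \int[mu]_(x in `]s, t]) f x.
Proof. by move=> fi st; apply: Rintegral_itvB => //; exact: integrableS fi. Qed.

Lemma continuous_primitive f : mu.-integrable setT (EFin \o f) ->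
  continuous (primitive f).
Proof.
move=> fi x.
have fab : mu.-integrable `[x - 1, x + 1] (EFin \o f) by exact: integrableS fi.
have x11 : x - 1 < x + 1 by lra.
have /(continuous_within_itvP _ x11)[+ _ _] :=
  parameterized_integral_continuous (ltW x11) fab.
have xx : x \in `]x - 1, x + 1[ by rewrite in_itv/=; apply/andP; split; lra.
move=> /(_ x xx) cx.
have E y : x - 1 <= y -> primitive f y =
    primitive f (x - 1) + parameterized_integral mu (x - 1) y f.
  move=> xy; rewrite /parameterized_integral -Rintegral_itv_obnd_cbnd.
    by rewrite -primitiveB// subrKC.
  exact: integrableS fi.
rewrite /continuous_at E; last lra.
apply: cvg_trans; last exact: (cvgD (cvg_cst (primitive f (x - 1))) cx).
apply: near_eq_cvg; near=> y; rewrite [RHS]E// ltW//.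
by near: y; apply: lt_nbhsr; lra.
Unshelve. all: by end_near. Qed.

Lemma lebesgue_stieltjes_itvoc (F : cumulative R R) s t : s <= t ->
  lebesgue_stieltjes_measure F `]s, t] = (F t - F s)%:E.
Proof.
move=> st; rewrite /lebesgue_stieltjes_measure /measure_extension/=.
by rewrite measurable_mu_extE/=; [exact: wlength_itv_bnd|exact: is_ocitv].
Qed.

Lemma ocitv_ind (P : set R -> Prop) : P set0 ->
  (forall s t, s <= t -> P `]s, t]%classic) ->
  forall X, ocitv X -> P X.
Proof. by move=> P0 Poc X /ocitvP[->//|[[s t] /= st ->]]; apply: Poc; exact: ltW. Qed.

(* The Stieltjes measures of [primitive h + z] and [primitive h - z] add up to the
   measure of density [2 * h], so the former is absolutely continuous with
   respect to the Lebesgue measure. *)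
Section dominated_increments.
Variables h z : R -> R.
Hypothesis hi : mu.-integrable setT (EFin \o h).
Hypothesis h0 : forall x, 0 <= h x.
Hypothesis zh : forall s t, s <= t -> `|z t - z s| <= \int[mu]_(x in `]s, t]) h x.

Let F t := primitive h t + z t.
Let G t := primitive h t - z t.
Let H t := 2 * primitive h t.

Let continuous_z : continuous z.
Proof.
move=> x; apply/cvgrPdist_le => e e0.
have cp := continuous_primitive hi.
have /cvgrPdist_le/(_ _ e0) := cp x.
have zP s t : s <= t -> `|z t - z s| <= primitive h t - primitive h s.
  by move=> st; rewrite primitiveB//; exact: zh.
apply: filterS => y he; have [xy|/ltW yx] := leP x y.
  rewrite distrC in he; rewrite distrC.
  exact: le_trans (zP _ _ xy) (le_trans (ler_norm _) he).
exact: le_trans (zP _ _ yx) (le_trans (ler_norm _) he).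
Qed.

Let F_nd : nondecreasing F.
Proof.
move=> s t st; rewrite -subr_ge0 /F.
have := zh st; rewrite -primitiveB// ler_norml => /andP[+ _]; lra.
Qed.

Let G_nd : nondecreasing G.
Proof.
move=> s t st; rewrite -subr_ge0 /G.
have := zh st; rewrite -primitiveB// ler_norml => /andP[_ +]; lra.
Qed.

Let H_nd : nondecreasing H.
Proof. by move=> s t st; have := F_nd st; have := G_nd st; rewrite /F /G /H; lra. Qed.

Let F_rc : right_continuous F.
Proof.
by apply: right_continuousW => x; apply: cvgD; [exact: continuous_primitive|exact: continuous_z].
Qed.

Let G_rc : right_continuous G.
Proof.
by apply: right_continuousW => x; apply: cvgB; [exact: continuous_primitive|exact: continuous_z].
Qed.

Let H_rc : right_continuous H.
Proof.
by apply: right_continuousW => x; apply: cvgM; [exact: cvg_cst|exact: continuous_primitive].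
Qed.

HB.instance Definition _ := isCumulative.Build R _ R F F_nd F_rc.
HB.instance Definition _ := isCumulative.Build R _ R G G_nd G_rc.
HB.instance Definition _ := isCumulative.Build R _ R H H_nd H_rc.

Let h2i : mu.-integrable setT (fun x => (2 * h x)%:E).
Proof. by under eq_fun do rewrite EFinM; exact: integrableZl. Qed.

Let h2_ge0 (A : set (measurableTypeR R)) : (0 <= induced_charge h2i A)%E.
Proof. by apply: integral_ge0 => x _; rewrite lee_fin mulr_ge0. Qed.

Let stieltjes_sum (A : set R) : measurable A ->
  (lebesgue_stieltjes_measure F A + lebesgue_stieltjes_measure G A =
   \int[mu]_(x in A) (2 * h x)%:E)%E.
Proof.
move=> mA.
rewrite -(measure_addE (lebesgue_stieltjes_measure F) (lebesgue_stieltjes_measure G)).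
pose nu2 : {measure set (measurableTypeR R) -> \bar R} := measure_of_charge _ h2_ge0.
rewrite -[RHS]/(nu2 A).
(* Since [H = F + G], both sides are identified with the Stieltjes measure of [H], which is
   determined by its values on half-open intervals. *)
transitivity (lebesgue_stieltjes_measure H A).
  apply/esym/lebesgue_stieltjes_measure_unique => //; apply: ocitv_ind.
    by rewrite !measure0.
  move=> s t st; rewrite [RHS]measure_addE lebesgue_stieltjes_itvoc//.
  transitivity ((F t - F s)%:E + (G t - G s)%:E)%E.
    rewrite -EFinD; congr EFin; pose p := primitive h.
    by rewrite -[LHS]/(2 * p t - 2 * p s) -[RHS]/(p t + z t - (p s + z s) +
      (p t - z t - (p s - z s))); ring.
  by congr (_ + _)%E; apply/esym; exact: lebesgue_stieltjes_itvoc.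
apply: (@lebesgue_stieltjes_measure_unique _ H nu2) => //.
apply: ocitv_ind; first by rewrite !measure0.
move=> s t st; rewrite lebesgue_stieltjes_itvoc// /H -mulrBr primitiveB//.
have hst : mu.-integrable `]s, t] (EFin \o h) by exact: integrableS hi.
rewrite -RintegralZl// /measure_of_charge /induced_charge.
rewrite /Rintegral fineK//; apply: integrable_fin_num => //.
exact: integrableS h2i.
Qed.

Lemma dominated_increments_primitive :
  exists2 w, mu.-integrable setT (EFin \o w) &
    forall s t, s <= t -> z t - z s = \int[mu]_(x in `]s, t]) w x.
Proof.
have LF_le (A : set R) : measurable A ->
    (lebesgue_stieltjes_measure F A <= \int[mu]_(x in A) (2 * h x)%:E)%E.
  by move=> mA; rewrite -stieltjes_sum// leeDl.
have LF_lty : (lebesgue_stieltjes_measure F setT < +oo)%E.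
  apply: le_lt_trans (LF_le _ measurableT) _.
  exact: integrable_lty.
pose nu : {finite_measure set (measurableTypeR R) -> \bar R} := mfrestr measurableT LF_lty.
have nuE A : nu A = lebesgue_stieltjes_measure F A.
  by rewrite /nu /= /mfrestr /mrestr setIT.
have nu_mu : nu `<< mu.
  apply/null_content_dominatesP => A mA A0; rewrite nuE.
  apply/eqP; rewrite eq_le measure_ge0 andbT.
  rewrite (le_trans (LF_le _ mA))// null_set_integral//.
  exact: (measurable_funTS (measurable_int _ h2i)).
have [n [n0 nfin ni nuint]] := radon_nikodym_sigma_finite nu_mu.
have nE : EFin \o (fine \o n) = n by apply/funext => x /=; rewrite fineK.
have wi : mu.-integrable setT (EFin \o (fun x => fine (n x) - h x)).
  rewrite (_ : _ \o _ = ((EFin \o (fine \o n)) \- (EFin \o h))%E).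
    by apply: integrableB => //; rewrite nE.
  by apply/funext => x /=; rewrite EFinB.
(* [n] is the density of the measure of [F = primitive h + z]; removing the density [h] of the first
   summand leaves that of [z]. *)
exists (fun x => fine (n x) - h x) => // s t st.
have mst : measurable `]s, t] by [].
have nst : \int[mu]_(x in `]s, t]) fine (n x) = F t - F s.
  rewrite /Rintegral; under eq_integral do rewrite fineK//.
  by rewrite -nuint// nuE lebesgue_stieltjes_itvoc.
rewrite RintegralB//.
- by rewrite nst -primitiveB// /F; ring.
- by apply: (@integrableS _ _ _ _ setT) => //; rewrite -[_ \o _]/(EFin \o (fine \o n)) nE.
- exact: integrableS hi.
Qed.
End dominated_increments.
End primitives.

(** * The play operator *)

Section play_operator.
Context {R : realType}.
Variable F : R -> R.
Implicit Types (s t u : R).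

(* The play started from the value 0 at time -oo: it exceeds c exactly when it
   did so at the start, or was pushed up to c by the lower threshold [F - 1] at
   some time s, and was not pushed below c by the upper one [F + 1] since. *)
Let levels t : set R :=
  [set c | (c <= 0 /\ forall u, u <= t -> c <= F u + 1) \/
           exists2 s, s <= t &
             c <= F s - 1 /\ forall u, s <= u <= t -> c <= F u + 1].

Definition play t : R := sup (levels t).

Let levels_lower t : levels t (F t - 1).
Proof.
right; exists t => //; split=> // u /andP[tu ut].
have -> : u = t by apply/le_anti; rewrite ut tu.
lra.
Qed.

Let levels_upper t : ubound (levels t) (F t + 1).
Proof. by move=> c [[_]|[s st [_]]]; apply; rewrite ?st ?lexx. Qed.

Let levels_has_sup t : has_sup (levels t).
Proof.
split; first by exists (F t - 1); exact: levels_lower.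
by exists (F t + 1); exact: levels_upper.
Qed.

Let levels_le_play t c : levels t c -> c <= play t.
Proof. exact: (sup_upper_bound (levels_has_sup t)). Qed.

Lemma play_ge t : F t - 1 <= play t. Proof. exact: levels_le_play. Qed.

Lemma play_le t : play t <= F t + 1.
Proof. by apply: ge_sup; [exact: (levels_has_sup t).1|exact: levels_upper]. Qed.

(** Every level at [t] is either already a level at [s], or was set at some time in []s, t]] by the
    lower threshold, which stays below [M]. *)
Lemma play_upper_bound s t M : s <= t -> play s <= M ->
  (forall u, s <= u <= t -> F u - 1 <= M) -> play t <= M.
Proof.
move=> st sM FM; apply: ge_sup; first exact: (levels_has_sup t).1.
move=> c [[c0 cF]|[r rt [cFr cF]]].
  apply: le_trans sM; apply: levels_le_play; left; split=> // u us.
  by apply: cF; exact: le_trans st.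
have [rs|/ltW sr] := leP r s; last first.
  by apply: le_trans cFr _; apply: FM; rewrite sr.
apply: le_trans sM; apply: levels_le_play; right; exists r => //; split=> // u.
by move=> /andP[ru us]; apply: cF; rewrite ru (le_trans us).
Qed.

(** Lowering a level at [s] to a value below the later upper thresholds makes it a level at [t]. The
    midpoint [c] leaves room on both sides: strictly below [play s], hence below some level at [s],
    and strictly above [play t]. *)
Lemma play_lower_bound s t m : s <= t -> m <= play s ->
  (forall u, s <= u <= t -> m <= F u + 1) -> m <= play t.
Proof.
move=> st ms mF; rewrite leNgt; apply/negP => tm.
pose c := (play t + m) / 2.
have cs : c < play s by rewrite /c; lra.
have cm : c <= m by rewrite /c; lra.
have [c' lc' cc'] := sup_gt (levels_has_sup s).1 cs.
suff /levels_le_play : levels t c by rewrite /c; lra.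
have cF u : s <= u -> u <= t -> c <= F u + 1.
  by move=> su ut; apply: le_trans cm _; apply: mF; rewrite su.
case: lc' => [[c'0 c'F]|[r rs [c'r c'F]]]; [left|right; exists r].
- split=> [|u ut]; first by lra.
  have [us|/ltW su] := leP u s; last exact: cF.
  by apply: le_trans (ltW cc') _; exact: c'F.
- exact: le_trans st.
- split=> [|u /andP[ru ut]]; first by lra.
  have [us|/ltW su] := leP u s; last exact: cF.
  by apply: le_trans (ltW cc') _; apply: c'F; rewrite ru.
Qed.

(** The two bounds above apply with [play s + B] and [play s - B]: [play s] lies between the
    thresholds at [s], and these move by at most [B] on [[s, t]]. *)
Lemma play_increment s t B : s <= t ->
  (forall u, s <= u <= t -> `|F u - F s| <= B) -> `|play t - play s| <= B.
Proof.
move=> st FB; have B0 : 0 <= B by have := FB s; rewrite lexx st subrr normr0; apply.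
have := play_ge s; have := play_le s => sF Fs.
have : play t <= play s + B.
  apply: play_upper_bound (st) _ _ => [|u /FB]; first by lra.
  by rewrite ler_norml => /andP[]; lra.
have : play s - B <= play t.
  apply: play_lower_bound (st) _ _ => [|u /FB]; first by lra.
  by rewrite ler_norml => /andP[]; lra.
by rewrite ler_norml => ? ?; apply/andP; split; lra.
Qed.

(** The starting value 0 lies between the constant thresholds [x - 1] and [x + 1], so it is never
    pushed. With [x = xi] this yields the initial condition. *)
Lemma play_start t x : -1 <= x <= 1 -> (forall u, u <= t -> F u = x) -> play t = 0.
Proof.
move=> /andP[x1 x2] Fx; apply/le_anti/andP; split; last first.
  by apply: levels_le_play; left; split=> // u /Fx ->; lra.
apply: ge_sup; first exact: (levels_has_sup t).1.
by move=> c [[]//|[s /Fx -> [+ _]]]; lra.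
Qed.
End play_operator.

(** * Test functions, and weak derivatives of primitives *)

Lemma integrable_mul_bounded d (X : measurableType d) (R : realType)
    (nu : {measure set X -> \bar R}) (f g : X -> R) (M : R) :
  nu.-integrable setT (EFin \o f) -> measurable_fun setT g ->
  (forall x, `|g x| <= M) -> nu.-integrable setT (fun x => (f x * g x)%:E).
Proof.
move=> fi mg gM; have /(_ measurableT fi mg) := @integrableMl _ _ _ nu setT _ (EFin \o f) g.
have -> : ((EFin \o f) \* (EFin \o g))%E = fun x => (f x * g x)%:E.
  by apply/funext => x /=; rewrite EFinM.
apply=> //; exists M; split; first exact: num_real.
by move=> y My x _; exact: le_trans (gM x) (ltW My).
Qed.

Section test_functions.
Context {R : realType}.
Notation mu := (@lebesgue_measure R).
Variable T : R.
Implicit Types (phi : R -> R) (x : R).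

Lemma test_function_is_derive phi : test_function T phi ->
  forall x, is_derive x 1 phi (derive1 phi x).
Proof.
by case=> d _ _ x; apply: DeriveDef; [exact: (d 0%N)|rewrite derive1E].
Qed.

Lemma test_function_continuous phi : test_function T phi -> continuous phi.
Proof.
by case=> d _ _ x; apply/differentiable_continuous/derivable1_diffP/(d 0%N).
Qed.

Lemma test_function_derive1_continuous phi : test_function T phi ->
  continuous (derive1 phi).
Proof.
by case=> d _ _ x; apply/differentiable_continuous/derivable1_diffP/(d 1%N).
Qed.

Lemma test_function_out phi x : test_function T phi -> ~ `]0, T[%classic x ->
  phi x = 0.
Proof.
case=> _ _ sub x0T; apply: contrapT => phix; apply/x0T/sub/subset_closure.
exact/eqP.
Qed.

Lemma test_function_derive1_out phi x : test_function T phi ->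
  ~ `]0, T[%classic x -> derive1 phi x = 0.
Proof.
move=> tphi x0T; have [_ _ sub] := tphi.
have : nbhs x (~` closure [set x | phi x != 0]).
  apply: open_nbhs_nbhs; split; last by move/sub.
  exact/closed_openC/closed_closure.
move=> nx; suff [_ <-] : is_derive x 1 phi 0 by rewrite derive1E.
apply: near_eq_is_derive (is_derive_cst 0 x 1).
apply: filterS nx => y /= ny; apply/esym; apply: contrapT => /eqP phiy.
exact/ny/subset_closure.
Qed.

Lemma test_function_integral_derive1 phi x : test_function T phi -> x < T ->
  \int[mu]_(t in `[x, T]) derive1 phi t = - phi x.
Proof.
move=> tphi xT.
rewrite /Rintegral (@continuous_FTC2 _ _ phi)//=.
- rewrite (test_function_out tphi); first by rewrite sub0r.
  by rewrite /= in_itv/= ltxx andbF.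
- exact/continuous_subspaceT/test_function_derive1_continuous.
- split=> [y _||].
  + by have [] := test_function_is_derive tphi y.
  + exact/cvg_at_right_filter/test_function_continuous.
  + exact/cvg_at_left_filter/test_function_continuous.
Qed.

Lemma continuous_integrable_itv (f : R -> R) (a b : R) : {within `[a, b], continuous f} ->
  mu.-integrable `[a, b] (EFin \o f).
Proof. by move=> cf; apply: continuous_compact_integrable => //; exact: segment_compact. Qed.

Lemma test_function_derive1_integrable phi : test_function T phi ->
  mu.-integrable setT (EFin \o derive1 phi).
Proof.
move=> tphi.
have : mu.-integrable `[0, T] (EFin \o derive1 phi).
  exact/continuous_integrable_itv/continuous_subspaceT/test_function_derive1_continuous.
rewrite integrable_mkcond// restrict_EFin.
congr integrable; apply/funext => x /=; rewrite patchE; case: ifPn => // xT.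
rewrite (test_function_derive1_out tphi)// => x0T; move/negP: xT; apply.
by rewrite inE; exact: subset_itv_oo_cc.
Qed.

Lemma test_function_integral_derive1T phi : 0 < T -> test_function T phi ->
  \int[mu]_t derive1 phi t = 0.
Proof.
move=> T0 tphi; transitivity (\int[mu]_(t in `[0, T]) derive1 phi t).
  rewrite [RHS]Rintegral_mkcond; apply: eq_Rintegral => x _.
  rewrite patchE; case: ifPn => // xT.
  rewrite (test_function_derive1_out tphi)// => x0T; move/negP: xT; apply.
  by rewrite inE; exact: subset_itv_oo_cc.
rewrite test_function_integral_derive1// (test_function_out tphi) ?oppr0//.
by rewrite /= in_itv/= ltxx.
Qed.

Lemma test_function_bounded phi : test_function T phi ->
  exists M, forall x, `|phi x| <= M.
Proof.
move=> tphi; have [T0|T0] := leP T 0.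
  exists 0 => x; rewrite (test_function_out tphi) ?normr0// /= in_itv/=.
  by apply/negP; rewrite negb_and -!leNgt; case: leP => //= x0; lra.
have cphi : {within `[0, T], continuous (fun x => `|phi x|)}.
  apply: continuous_subspaceT => x; apply: cvg_norm.
  exact: test_function_continuous tphi x.
have [c _ phic] := EVT_max (ltW T0) cphi.
exists `|phi c| => x; have [/subset_itv_oo_cc/phic//|x0T] := pselect (`]0, T[%classic x).
by rewrite (test_function_out tphi)// normr0.
Qed.

(** Integration by parts through Fubini for [phi'(t) v0(s)] on the half-plane [s <= t]: integrating
    in [s] first produces [primitive v0], integrating in [t] first produces [- phi(s)]. The constant
    [c] drops out because [phi'] has integral zero. *)
Lemma primitive_weak_derivative (v : R -> R) (c : R) :
  0 < T -> L2 T v ->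
  is_weak_derivative T (fun t => c + primitive (v \_ `]0, T[) t) v.
Proof.
move=> T0 vL2 phi tphi; set v0 := v \_ `]0, T[; set p := derive1 phi.
have v0i : mu.-integrable setT (EFin \o v0) by exact: L2_integrable.
have pi : mu.-integrable setT (EFin \o p) by exact: test_function_derive1_integrable.
have p_out x : ~ `]0, T[%classic x -> p x = 0 by exact: test_function_derive1_out.
pose A : set (R * R) := [set q | q.2 <= q.1].
have mA : measurable A.
  rewrite (_ : A = (fun q : R * R => q.1 - q.2) @^-1` `[0, +oo[).
    rewrite -[X in measurable X]setTI.
    have mB : measurable_fun setT (fun q : R * R => q.1 - q.2).
      by apply: measurable_funB; [exact: measurable_fst|exact: measurable_snd].
    exact: mB.
  by apply/seteqP; split => q /=; rewrite in_itv/= andbT subr_ge0.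
pose K (q : R * R) : R := p q.1 * v0 q.2.
have mp : measurable_fun setT p.
  by apply: continuous_measurable_fun; exact: test_function_derive1_continuous tphi.
have mv0 : measurable_fun setT v0 by exact: L2_measurable.
have mK : measurable_fun setT K.
  by apply: measurable_funM; exact: measurableT_comp.
have Ki : (mu \x mu)%E.-integrable setT (EFin \o K).
  apply/integrable12ltyP; first exact/measurable_EFinP.
  have mnv0 : measurable_fun setT (fun y => `|v0 y|%:E).
    by apply/measurable_EFinP; exact: measurableT_comp.
  under eq_integral.
    move=> x _; rewrite (_ : (\int[mu]_y _)%E =
        (`|p x|%:E * \int[mu]_y `|v0 y|%:E)%E); last first.
      rewrite -ge0_integralZl//.
      by apply: eq_integral => y _; rewrite /= normrM EFinM.
    over.
  have v0n : (\int[mu]_y `|v0 y|%:E)%E \is a fin_num.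
    by apply: integrable_fin_num => //; have /integrable_norm := v0i.
  have -> : (\int[mu]_y `|v0 y|%:E)%E = (\int[mu]_y `|v0 y|)%:E.
    by rewrite /Rintegral fineK.
  have pn : mu.-integrable setT (fun x => `|p x|%:E) by have /integrable_norm := pi.
  by rewrite integralZr// ltey_eq fin_numM// integrable_fin_num.
have KAi : (mu \x mu)%E.-integrable setT (EFin \o K \_ A).
  by rewrite -restrict_EFin -integrable_mkcond//; exact: integrableS Ki.
have EFin_Rintegral (D : set R) f : measurable D -> mu.-integrable D (EFin \o f) ->
    (\int[mu]_(x in D) (f x)%:E)%E = (\int[mu]_(x in D) f x)%:E.
  by move=> mD fi; rewrite /Rintegral fineK//; exact: integrable_fin_num.
have Zi (D : set R) r f : measurable D -> mu.-integrable setT (EFin \o f) ->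
    mu.-integrable D (EFin \o (fun x => r * f x)).
  move=> mD fi; rewrite (_ : _ \o _ = fun x => (r%:E * (EFin \o f) x)%E).
    by apply: integrableZl => //; exact: integrableS fi.
  by apply/funext => x /=; rewrite EFinM.
have memA t s : ((t, s) \in A) = (s <= t) by apply/idP/idP; rewrite inE.
have inner1 t : (\int[mu]_s ((K \_ A) (t, s))%:E = (p t * primitive v0 t)%:E)%E.
  transitivity (\int[mu]_(s in `]-oo, t]) (p t * v0 s)%:E)%E.
    rewrite [RHS]integral_mkcond; apply: eq_integral => s _.
    by rewrite !patchE memA [in RHS]mem_setE in_itv/=; case: ifP.
  rewrite EFin_Rintegral//; last exact: Zi.
  by rewrite RintegralZl//; exact: integrableS v0i.
have inner2 s : (\int[mu]_t ((K \_ A) (t, s))%:E = (- (v0 s * phi s))%:E)%E.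
  have [s0T|s0T] := pselect (`]0, T[%classic s); last first.
    have v0s : v0 s = 0 by rewrite /v0 patchE ifF//; apply/negP; rewrite inE.
    rewrite v0s mul0r oppr0; apply: integral0_eq => x _.
    by rewrite patchE /K/= v0s mulr0; case: ifP.
  have sT : s < T by move: s0T; rewrite /= in_itv/= => /andP[].
  transitivity (\int[mu]_(t in `[s, T]) (v0 s * p t)%:E)%E.
    rewrite [RHS]integral_mkcond; apply: eq_integral => t _.
    rewrite !patchE memA [in RHS]mem_setE in_itv/= /K/=; case: (leP s t) => //= st.
    case: leP => // Tt; first by rewrite mulrC.
    by rewrite p_out ?mul0r//= in_itv/= => /andP[_]; rewrite ltNge (ltW Tt).
  rewrite EFin_Rintegral//; last exact: Zi.
  rewrite RintegralZl//; last exact: integrableS pi.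
  by rewrite test_function_integral_derive1// mulrN.
have := Fubini KAi.
under eq_integral do rewrite /= inner1.
under [in RHS]eq_integral do rewrite /= inner2.
move=> /(congr1 fine) fub.
rewrite Rintegral_mkcond.
transitivity (\int[mu]_t (c * p t + p t * primitive v0 t)).
  apply: eq_Rintegral => x _; rewrite patchE; case: ifPn => [_|xT].
    by rewrite mulrDl [primitive _ _ * _]mulrC.
  by rewrite p_out ?mulr0 ?mul0r ?addr0// => x0T; move/negP: xT; rewrite inE.
have pPi : mu.-integrable setT (fun t => (p t * primitive v0 t)%:E).
  have := integrable_fubini_F KAi; rewrite /fubini_F.
  by under eq_fun do rewrite /= inner1.
have vphii : mu.-integrable setT (fun s => (v0 s * phi s)%:E).
  have [M phiM] := test_function_bounded tphi.
  have mphi : measurable_fun setT phi.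
    by apply: continuous_measurable_fun; exact: test_function_continuous tphi.
  exact: (@integrable_mul_bounded _ _ _ mu v0 phi M v0i mphi phiM).
rewrite RintegralD//; last exact: Zi.
rewrite RintegralZl// test_function_integral_derive1T// mulr0 add0r.
rewrite [LHS]fub [in RHS]Rintegral_mkcond.
transitivity (\int[mu]_s (-1 * (v0 s * phi s))).
  by apply: eq_Rintegral => x _; rewrite mulN1r.
rewrite RintegralZl// mulN1r; congr (- _); apply: eq_Rintegral => x _.
by rewrite /v0 !patchE; case: ifP => //; rewrite mul0r.
Qed.
End test_functions.

(** * Recovering increments from weak derivatives *)

Section weak_derivative_theory.
Context {R : realType}.
Notation mu := (@lebesgue_measure R).
Variable T : R.
Implicit Types (c e x a b : R) (y d v : R -> R).

(** For [e > 0], a smooth version of the indicator of []c, +oo[] whose rise takes place in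
    [[c, c + e]]. *)
Definition step c e x : R := smooth_step (e^-1 * x + - (e^-1 * c)).

Lemma times_differentiable_step n c e : times_differentiable n (step c e).
Proof. exact/times_differentiable_affine/times_differentiable_smooth_step. Qed.

Lemma step_is_derive c e x :
  is_derive x 1 (step c e) (derive1 (step c e) x).
Proof.
apply: DeriveDef; last by rewrite derive1E.
exact: (times_differentiable_derivable (times_differentiable_step 1 c e)).
Qed.

Lemma step_continuous c e : continuous (step c e).
Proof.
by move=> x; apply/differentiable_continuous/derivable1_diffP; have [] := step_is_derive c e x.
Qed.

Lemma step_derive1_continuous c e : continuous (derive1 (step c e)).
Proof.
move=> x; apply/differentiable_continuous/derivable1_diffP.
exact: (times_differentiable_derivable (times_differentiable_step 2 c e)).
Qed.

Lemma step_le c e x : 0 < e -> x <= c -> step c e x = 0.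
Proof.
move=> e0 xc; apply: smooth_step_le0; rewrite -mulrBr.
by apply: mulr_ge0_le0; rewrite ?subr_le0// invr_ge0 ltW.
Qed.

Lemma step_ge c e x : 0 < e -> c + e <= x -> step c e x = 1.
Proof.
move=> e0 xc; apply: smooth_step_ge1; rewrite -mulrBr mulrC ler_pdivlMr// mul1r.
lra.
Qed.

Lemma step_itv c e x : 0 <= step c e x <= 1.
Proof. exact: smooth_step_itv. Qed.

Lemma step_derive1_ge0 c e x : 0 < e -> 0 <= derive1 (step c e) x.
Proof.
move=> e0.
have ds (z : R) : is_derive z 1 smooth_step (derive1 smooth_step z).
  apply: DeriveDef; last by rewrite derive1E.
  exact: (times_differentiable_derivable (times_differentiable_smooth_step 1)).
have da : is_derive x 1 (fun x => e^-1 * x + - (e^-1 * c)) e^-1.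
  move: (- (e^-1 * c)) => b; by apply: is_derive_eq; rewrite addr0 /GRing.scale/= mulr1.
rewrite derive1E; have [_ ->] : is_derive x 1 (step c e) _ := is_derive1_comp (ds _) da.
rewrite mulr_ge0 ?smooth_step_derive1_ge0//.
by rewrite invr_ge0 ltW.
Qed.

Lemma step_derive1_out c e x : 0 < e -> ~ `[c, c + e]%classic x ->
  derive1 (step c e) x = 0.
Proof.
move=> e0 xce.
suff [k kx] : exists k, \near x, cst k x = step c e x.
  have [_ <-] := near_eq_is_derive kx (is_derive_cst k x 1).
  by rewrite derive1E.
have [xc|cx] := ltP x c.
  exists 0; near=> z; rewrite step_le//= ltW//.
  by near: z; exact: lt_nbhsl.
have ex : c + e < x by rewrite ltNge; apply/negP => xe; apply: xce; rewrite /= in_itv/= cx.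
exists 1; near=> z; rewrite step_ge//= ltW//.
by near: z; exact: lt_nbhsr.
Unshelve. all: by end_near. Qed.

(** Before [a] both steps are 0 and after [b + e] both are 1, so the support lies in
    [[a, b + e]]. *)
Lemma test_function_stepB a b e : 0 < a -> a <= b -> 0 < e -> b + e < T ->
  test_function T (fun x => step a e x - step b e x).
Proof.
move=> a0 ab e0 beT.
have sub : closure [set x | step a e x - step b e x != 0] `<=` `[a, b + e].
  have /closure_id -> : closed `[a, b + e]%classic by exact: itv_closed.
  apply: closure_subset => x /= sx; rewrite in_itv/=; apply/andP; split.
    rewrite leNgt; apply: contra sx => xa.
    by rewrite !step_le ?subrr// ltW// (lt_le_trans xa).
  rewrite leNgt; apply: contra sx => bx.
  rewrite !step_ge ?subrr// ?ltW//; first lra.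
split.
- move=> n; apply: times_differentiable_derivable.
  rewrite (_ : (fun _ => _) = (fun x => step a e x + -1 * step b e x)); last first.
    by apply/funext => x; rewrite mulN1r.
  apply: times_differentiableD; first exact: times_differentiable_step.
  exact/times_differentiableZ/times_differentiable_step.
- apply: subclosed_compact sub; [exact: closed_closure|exact: segment_compact].
- apply: subset_trans sub _ => x /=; rewrite !in_itv/= => /andP[ax xb].
  by apply/andP; split; lra.
Qed.

Lemma integral_step_derive1 c e : 0 < e ->
  \int[mu]_(t in `[c, c + e]) derive1 (step c e) t = 1.
Proof.
move=> e0; rewrite /Rintegral (@continuous_FTC2 _ _ (step c e))//=.
- by rewrite step_ge// step_le// subr0.
- by rewrite ltrDl.
- exact/continuous_subspaceT/step_derive1_continuous.
- split=> [y _||].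
  + by have [] := step_is_derive c e y.
  + exact/cvg_at_right_filter/step_continuous.
  + exact/cvg_at_left_filter/step_continuous.
Qed.

(** The derivative of the step is nonnegative, has integral 1 and lives on [[c, c + e]], so the
    integral is an average of [y] over that interval and continuity at [c] gives the limit. *)
Lemma step_derive1_average y c : {within `[0, T], continuous y} -> 0 < c < T ->
  \int[mu]_(t in `]0, T[) (y t * derive1 (step c e) t) @[e --> 0^'+] --> y c.
Proof.
move=> cy c0T; have [c0 cT] := andP c0T; have T0 := lt_trans c0 cT.
have /(continuous_within_itvP _ T0)[/(_ c) + _ _] := cy.
rewrite in_itv/= c0T => /(_ isT)/cvgrPdist_le/= cyc.
apply/cvgrPdist_le => /= r r0.
have [del /= del0 yc] := cyc _ r0.
near=> e.
have e0 : 0 < e by near: e; exact: nbhs_right_gt.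
have edel : e < del by near: e; exact: nbhs_right_lt.
have eT : e < T - c by near: e; apply: nbhs_right_lt; rewrite subr_gt0.
set s' := derive1 (step c e).
have sub : `[c, c + e] `<=` `]0, T[%classic.
  by move=> x /=; rewrite !in_itv/= => /andP[? ?]; apply/andP; split; lra.
have cy' : {within `[c, c + e], continuous y}.
  by apply: continuous_subspaceW cy; apply: subset_trans sub _; exact: subset_itv_oo_cc.
have cs' : {within `[c, c + e], continuous s'}.
  exact/continuous_subspaceT/step_derive1_continuous.
have -> : \int[mu]_(t in `]0, T[) (y t * s' t) = \int[mu]_(t in `[c, c + e]) (y t * s' t).
  rewrite Rintegral_mkcond [RHS]Rintegral_mkcond; apply: eq_Rintegral => x _.
  have [xce|xce] := pselect (`[c, c + e]%classic x).
    by rewrite !patchE !mem_set//; exact: sub.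
  by rewrite !patchE [X in _ * X](step_derive1_out e0 xce) mulr0 !if_same.
have -> : y c = \int[mu]_(t in `[c, c + e]) (y c * s' t).
  by rewrite RintegralZl// ?integral_step_derive1 ?mulr1//; exact: continuous_integrable_itv.
rewrite -RintegralB//; last 2 first.
- by apply: continuous_integrable_itv => x; apply: cvgM; [exact: cvg_cst|exact: cs'].
- by apply: continuous_integrable_itv => x; apply: cvgM; [exact: cy'|exact: cs'].
under eq_Rintegral do rewrite -mulrBl.
have ci : mu.-integrable `[c, c + e] (EFin \o (fun t => (y c - y t) * s' t)).
  apply: continuous_integrable_itv => x; apply: cvgM; last exact: cs'.
  by apply: cvgB; [exact: cvg_cst|exact: cy'].
apply: le_trans (le_normr_Rintegral _ ci) _ => //.
rewrite -[leRHS]mulr1 -(integral_step_derive1 c e0) -RintegralZl//; last first.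
  exact: continuous_integrable_itv.
apply: le_Rintegral => //.
- by have /integrable_norm := ci.
- by apply: continuous_integrable_itv => x; apply: cvgM; [exact: cvg_cst|exact: cs'].
move=> x /=; rewrite in_itv/= => /andP[cx xce].
rewrite normrM (ger0_norm (step_derive1_ge0 _ _ e0)).
apply: ler_wpM2r; first exact: step_derive1_ge0.
apply: yc; rewrite /= ler0_norm; lra.
Unshelve. all: by end_near. Qed.

(** Within []0, T[] the step differs from the indicator of []c, T]] only on []c, c + e]], so the
    error is at most the integral of [|d|] there, which vanishes in the limit because the primitive
    of [|d|] is continuous. *)
Lemma step_average d c : L2 T d -> 0 < c < T ->
  \int[mu]_(t in `]0, T[) (d t * step c e t) @[e --> 0^'+] -->
  primitive (d \_ `]0, T[) T - primitive (d \_ `]0, T[) c.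
Proof.
move=> dL2 /andP[c0 cT]; set d0 := d \_ `]0, T[.
have d0i : mu.-integrable setT (EFin \o d0) by exact: L2_integrable.
have d0n : mu.-integrable setT (EFin \o (fun x => `|d0 x|)).
  by have /integrable_norm := d0i.
have d0c : mu.-integrable setT (EFin \o (d0 \_ `]c, T])).
  by rewrite -restrict_EFin -integrable_mkcond//; exact: integrableS d0i.
have /cvgrPdist_le/= cP := continuous_primitive d0n (x := c).
apply/cvgrPdist_le => /= r r0.
have [del /= del0 Pdel] := cP _ r0.
near=> e.
have e0 : 0 < e by near: e; exact: nbhs_right_gt.
have edel : e < del by near: e; exact: nbhs_right_lt.
have eT : e < T - c by near: e; apply: nbhs_right_lt; rewrite subr_gt0.
have d0s : mu.-integrable setT (fun x => (d0 x * step c e x)%:E).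
  apply: (@integrable_mul_bounded _ _ _ mu d0 (step c e) 1) => //.
    by apply: continuous_measurable_fun; exact: step_continuous.
  by move=> x; rewrite ger0_norm; have /andP[] := step_itv c e x.
rewrite (primitiveB d0i (ltW cT)) Rintegral_mkcond.
rewrite (_ : \int[mu]_(t in `]0, T[) _ = \int[mu]_t (d0 t * step c e t)); last first.
  rewrite Rintegral_mkcond; apply: eq_Rintegral => x _.
  by rewrite /d0 !patchE; case: ifP => // _; rewrite mul0r.
rewrite -RintegralB//.
have di : mu.-integrable setT
    (EFin \o (fun x => (d0 \_ `]c, T]) x - d0 x * step c e x)).
  rewrite (_ : _ \o _ = (EFin \o (d0 \_ `]c, T])) \- (fun x => (d0 x * step c e x)%:E))%E.
    exact: integrableB.
  by apply/funext => x /=; rewrite EFinB.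
apply: le_trans (le_normr_Rintegral _ di) _ => //.
have cce : c <= c + e by lra.
apply: (@le_trans _ _ (\int[mu]_(x in `]c, c + e]) `|d0 x|)).
  rewrite [leRHS]Rintegral_mkcond; apply: le_Rintegral => //.
  - by have /integrable_norm := di.
  - by rewrite -restrict_EFin -integrable_mkcond//; exact: integrableS d0n.
  move=> x _; have [xT|xT] := pselect (`]0, T[%classic x); last first.
    have d0x : d0 x = 0 by rewrite /d0 patchE memNset.
    by rewrite !patchE d0x normr0 mul0r !if_same subrr normr0.
  move: (xT); rewrite /= in_itv/= => /andP[x0 xlT].
  rewrite !patchE !mem_setE !in_itv/= (ltW xlT) andbT.
  have [cx|xc] := ltP c x; last by rewrite step_le// mulr0 subr0 normr0.
  have [xce|/ltW cex] /= := leP x (c + e); last by rewrite step_ge// mulr1 subrr normr0.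
  have /andP[s0 s1] := step_itv c e x.
  rewrite -[X in X - _]mulr1 -mulrBr normrM ler_piMr// ger0_norm; lra.
rewrite -primitiveB//; apply: le_trans (ler_norm _) _.
rewrite distrC; apply: Pdel; rewrite /= opprD addNKr normrN gtr0_norm//.
Unshelve. all: by end_near. Qed.

(** Testing with [step a e - step b e] and letting [e] tend to 0 gives [y a - y b] on one side and
    minus the integral of [d] over []a, b]] on the other. The points are interior so that the
    supports fit in []0, T[]. *)
Lemma weak_derivative_increment y d a b :
  {within `[0, T], continuous y} -> L2 T d -> is_weak_derivative T y d ->
  0 < a -> a <= b -> b < T ->
  y b - y a = primitive (d \_ `]0, T[) b - primitive (d \_ `]0, T[) a.
Proof.
move=> cy dL2 yd a0 ab bT; set P := primitive _.
have a0T : 0 < a < T by rewrite a0 (le_lt_trans ab).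
have b0T : 0 < b < T by rewrite bT (lt_le_trans a0).
have F0 : Filter (0 : R)^'+ by apply: within_filter.
have /(_ F0) lhs := cvgB (step_derive1_average cy a0T) (step_derive1_average cy b0T).
have /(_ F0 F0) rhs := cvgN (cvgB (step_average dL2 a0T) (step_average dL2 b0T)).
suff : y a - y b = - (P T - P a - (P T - P b)) by lra.
rewrite -(cvg_lim (@Rhausdorff R) lhs); apply/cvg_lim; first exact: Rhausdorff.
apply: cvg_trans rhs; apply: near_eq_cvg; near=> e.
have e0 : 0 < e by near: e; exact: nbhs_right_gt.
have eT : e < T - b by near: e; apply: nbhs_right_lt; rewrite subr_gt0.
have tf : test_function T (fun x => step a e x - step b e x).
  by apply: test_function_stepB => //; lra.
have := yd _ tf.
have -> : derive1 (fun x => step a e x - step b e x) =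
    (fun x => derive1 (step a e) x - derive1 (step b e) x).
  apply/funext => x; rewrite derive1E.
  by have [_ ->] := is_deriveB (step_is_derive a e x) (step_is_derive b e x).
have yi c : mu.-integrable `]0, T[ (EFin \o (fun x => y x * derive1 (step c e) x)).
  have : mu.-integrable `[0, T] (EFin \o (fun x => y x * derive1 (step c e) x)).
    apply: continuous_integrable_itv => x; apply: cvgM; first exact: cy.
    exact: (continuous_subspaceT (@step_derive1_continuous c e)).
  by apply: integrableS => //; exact: subset_itv_oo_cc.
have di c : mu.-integrable `]0, T[ (EFin \o (fun x => d x * step c e x)).
  rewrite (@integrable_mkcond _ _ _ mu `]0, T[)//.
  have d0s := @integrable_mul_bounded _ _ _ mu (d \_ `]0, T[) (step c e) 1.
  have := d0s (L2_integrable dL2).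
  rewrite (_ : (fun x => ((d \_ `]0, T[) x * step c e x)%:E) =
      (EFin \o (fun x => d x * step c e x)) \_ `]0, T[); last first.
    by apply/funext => x; rewrite /= !patchE; case: ifP => //; rewrite mul0r.
  apply; first by apply: continuous_measurable_fun; exact: step_continuous.
  by move=> x; rewrite ger0_norm; have /andP[] := step_itv c e x.
under eq_Rintegral do rewrite mulrBr.
under [in RHS]eq_Rintegral do rewrite mulrBr.
by rewrite !RintegralB// => ydE; rewrite !fctE /= ydE.
Unshelve. all: by end_near. Qed.

Lemma primitive_is_derive v : mu.-integrable setT (EFin \o v) ->
  {ae mu, forall t : R, is_derive t 1 (primitive v) (v t)}.
Proof.
move=> vi; have h (y : R) : mu.-integrable [set` `]-oo, y]] (EFin \o v).
  exact: integrableS vi.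
have vloc : locally_integrable setT v.
  rewrite (_ : v = v \_ setT); first exact: integrable_locally.
  by apply/funext => x; rewrite patchE mem_set.
have := FTC1Ny h vloc.
apply: filterS; first exact: (ae_filter_ringOfSetsType mu).
move=> t [dP <-].
by apply: DeriveDef => //; rewrite derive1E.
Qed.

(** Both primitives have the increments of [y], so near an interior point they differ by a constant
    and share their derivative; Lebesgue differentiation turns this into equality of [v] and [d]. *)
Lemma weak_derivative_unique y v d :
  {within `[0, T], continuous y} -> L2 T v -> L2 T d ->
  is_weak_derivative T y v -> is_weak_derivative T y d ->
  {ae mu, forall t, 0 < t < T -> v t = d t}.
Proof.
move=> cy vL2 dL2 yv yd.
have := primitive_is_derive (L2_integrable vL2).
have := primitive_is_derive (L2_integrable dL2).
apply: filterS2; first exact: (ae_filter_ringOfSetsType mu).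
move=> t dd dv t0T; have /andP[t0 tT] := t0T.
have tin : `]0, T[%classic t by rewrite /= in_itv/=.
have -> : v t = (v \_ `]0, T[) t by rewrite patchE mem_set.
have -> : d t = (d \_ `]0, T[) t by rewrite patchE mem_set.
set Pv := primitive (v \_ `]0, T[) in dv *; set Pd := primitive (d \_ `]0, T[) in dd *.
have [_ <-] := dv; have [_ <-] := dd.
suff nE : \forall s \near t, Pd s + (Pv t - Pd t) = Pv s.
  have := near_eq_is_derive (f := Pd \+ cst (Pv t - Pd t)) nE
    (is_deriveD dd (is_derive_cst (Pv t - Pd t) t 1)).
  by rewrite addr0 => -[_ ->]; have [_ ->] := dd.
near=> s.
have s0 : 0 < s by near: s; exact: lt_nbhsr.
have sT : s < T by near: s; exact: lt_nbhsl.
have [st|/ltW ts] := leP s t.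
  have := weak_derivative_increment cy vL2 yv s0 st tT.
  have := weak_derivative_increment cy dL2 yd s0 st tT.
  by rewrite -/Pv -/Pd; lra.
have := weak_derivative_increment cy vL2 yv t0 ts sT.
have := weak_derivative_increment cy dL2 yd t0 ts sT.
by rewrite -/Pv -/Pd; lra.
Unshelve. all: by end_near. Qed.
End weak_derivative_theory.

(** * Sign conditions for the subdifferential *)

Section subdifferential_of_indicator.
Context {R : realType}.
Implicit Types x p q : R.

Lemma subdiff_ind_norm_le1 x p : subdiff_ind x p -> -1 <= x <= 1.
Proof.
move=> xp; have [_ _ _ gt1] := subdiff_indE x.
by rewrite -ler_norml leNgt; apply/negP => /gt1 E; rewrite E in xp.
Qed.

Lemma subdiff_ind_le0 x p : subdiff_ind x p -> x < 1 -> p <= 0.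
Proof.
move=> xp x1; have /andP[x0 _] := subdiff_ind_norm_le1 xp.
have [_ eN1 lt1 _] := subdiff_indE x.
move: x0; rewrite le_eqVlt => /predU1P[/esym/eN1 E|x0]; first by rewrite E in xp.
by move: xp; rewrite lt1 ?ltr_norml ?x0// => ->.
Qed.

Lemma subdiff_ind_ge0 x p : subdiff_ind x p -> -1 < x -> 0 <= p.
Proof.
move=> xp x0; have /andP[_ x1] := subdiff_ind_norm_le1 xp.
have [e1 _ lt1 _] := subdiff_indE x.
move: x1; rewrite le_eqVlt => /predU1P[/e1 E|x1]; first by rewrite E in xp.
by move: xp; rewrite lt1 ?ltr_norml ?x0// => ->.
Qed.

(** The three cases are recast as two one-sided sign conditions, the form in which the derivative of
    the play is controlled. *)
Lemma subdiff_ind_intro x p : -1 <= x <= 1 -> (-1 < x -> 0 <= p) ->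
  (x < 1 -> p <= 0) -> subdiff_ind x p.
Proof.
move=> /andP[x0 x1] p0 p1; have [e1 eN1 lt1 _] := subdiff_indE x.
have [xE|xn1] := eqVneq x 1; first by rewrite e1//=; apply: p0; lra.
have [xE|xnN1] := eqVneq x (-1); first by rewrite eN1//=; apply: p1; lra.
have x1' : x < 1 by rewrite lt_neqAle xn1.
have x0' : -1 < x by rewrite lt_neqAle eq_sym xnN1.
rewrite lt1 ?ltr_norml ?x0'//=; apply/le_anti; by rewrite p0// p1.
Qed.

(** For [x < y] in [[-1, 1]] one has [x < 1] and [-1 < y], hence [p <= 0 <= q]. *)
Lemma subdiff_ind_monotone x y p q :
  subdiff_ind x p -> subdiff_ind y q -> x < y -> p <= q.
Proof.
move=> xp yq xy; have /andP[x0 x1] := subdiff_ind_norm_le1 xp.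
have /andP[y0 y1] := subdiff_ind_norm_le1 yq.
apply: (@le_trans _ _ 0); first by apply: subdiff_ind_le0 xp _; lra.
by apply: subdiff_ind_ge0 yq _; lra.
Qed.
End subdifferential_of_indicator.

(** * Existence and uniqueness of solutions *)

Section existence_uniqueness.
Context {R : realType}.
Notation mu := (@lebesgue_measure R).
Implicit Types (y z v : R -> R).

(** Comparison on the right is enough because the derivative is known to exist; the bounds on the
    play only look forward in time. *)
Lemma is_derive_ge0 (f : R -> R) (t df : R) : is_derive t 1 f df ->
  (\forall s \near t^'+, f t <= f s) -> 0 <= df.
Proof.
case=> dfd <- [/= e e0 fe]; rewrite leNgt; apply/negP => D0.
have D0' : 0 < - 'D_1 f t by rewrite oppr_gt0.
have /cvgrPdist_lt/(_ _ D0') [/= del del0 H] :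
    (fun h => h^-1 *: ((f \o shift t) (h *: 1) - f t)) @ 0^' --> 'D_1 f t.
  exact: dfd.
have [m [m0 me mdel]] : exists m, [/\ 0 < m, m <= e & m <= del].
  by exists (Num.min e del); rewrite lt_min e0 del0 !ge_min !lexx orbT.
pose h := m / 2; have h0 : 0 < h by rewrite divr_gt0.
have [he hdel] : h < e /\ h < del by rewrite /h; split; lra.
have := H h; rewrite /= sub0r normrN gtr0_norm// gt_eqF//.
have hE : (h *: 1 + t : R) = t + h by rewrite /GRing.scale/= mulr1 addrC.
rewrite hE; have fth : f t <= f (t + h).
  by apply: fe; rewrite /= ?ltrDl// opprD addNKr normrN gtr0_norm.
have q0 : 0 <= h^-1 * (f (t + h) - f t) by rewrite mulr_ge0 ?subr_ge0// invr_ge0 ltW.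
by move=> /(_ hdel isT); rewrite ltr_norml => /andP[+ _]; move: q0; rewrite /GRing.scale/=; lra.
Qed.

Lemma ae_le_Rintegral (D : set R) (f g : R -> R) : measurable D ->
  mu.-integrable D (EFin \o f) -> mu.-integrable D (EFin \o g) ->
  {ae mu, forall x, D x -> f x <= g x} ->
  \int[mu]_(x in D) f x <= \int[mu]_(x in D) g x.
Proof.
move=> mD fi gi fg; rewrite -subr_ge0 -RintegralB//.
have mgf : measurable_fun D (fun x => g x - f x).
  have /measurable_int/measurable_EFinP mf := fi.
  have /measurable_int/measurable_EFinP mg := gi.
  exact: measurable_funB.
rewrite (_ : \int[mu]_(x in D) (g x - f x) =
    \int[mu]_(x in D) Num.max (g x - f x) 0); last first.
  congr fine; apply: ae_eq_integral => //.
  - exact/measurable_EFinP.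
  - by apply/measurable_EFinP; exact: measurable_maxr.
  move: fg; apply: filterS; first exact: (ae_filter_ringOfSetsType mu).
  by move=> x fgx Dx; rewrite max_l// subr_ge0 fgx.
by apply: Rintegral_ge0 => x _; rewrite le_max lexx orbT.
Qed.

Lemma ddtP T y : H1 T y -> L2 T (ddt T y) /\ is_weak_derivative T y (ddt T y).
Proof.
move=> [_ _ [v vL2 yv]].
have := @xgetPex _ (fun=> 0) [set v | L2 T v /\ is_weak_derivative T y v].
by apply; exists v.
Qed.

Lemma within_continuousP (T : R) y : {within `[0, T], continuous y} ->
  forall x r, 0 <= x <= T -> 0 < r ->
  exists2 del, 0 < del & forall s, 0 <= s <= T -> `|x - s| < del -> `|y x - y s| < r.
Proof.
move=> /subspace_continuousP/= cy x r xT r0.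
have xin : `[0, T]%classic x by rewrite /= in_itv/=.
have /cvgrPdist_lt/(_ _ r0) [del /= del0 h] := cy x xin.
by exists del => // s sT xs; apply: h => //; rewrite /= in_itv.
Qed.

Section fixed_data.
Variables (T k rho1 rho2 xi : R) (u : R -> R).
Hypotheses (T_gt0 : 0 < T) (uL2 : L2 T u) (xi1 : -1 <= xi <= 1).
Notation sol := (solution T k rho1 rho2 u xi).

Lemma solution_exists : exists y, sol y.
Proof.
pose f := g_rho k rho1 rho2 \o u.
have fL2 : L2 T f by exact: L2_g_rho.
set f0 := f \_ `]0, T[.
have f0i : mu.-integrable setT (EFin \o f0) by exact: L2_integrable.
pose h x := `|f0 x|.
have hi : mu.-integrable setT (EFin \o h) by have /integrable_norm := f0i.
have h0 x : 0 <= h x by exact: normr_ge0.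
pose F t := xi + primitive f0 t.
have cF : continuous F.
  by move=> t; apply: cvgD; [exact: cvg_cst|exact: continuous_primitive].
have F0 t : t <= 0 -> F t = xi.
  move=> t0; rewrite /F /primitive (_ : \int[mu]_(x in _) _ = 0) ?addr0//.
  rewrite Rintegral_mkcond (_ : f0 \_ _ = cst 0) ?Rintegral_cst ?mul0r//.
  apply/funext => x; rewrite patchE; case: ifPn => //; rewrite mem_setE in_itv/= => xt.
  by rewrite /f0 patchE memNset//= in_itv/= => /andP[]; lra.
pose zeta := play F.
have zeta0 : zeta 0 = 0 by exact: play_start xi1 F0.
have zetah s t : s <= t -> `|zeta t - zeta s| <= \int[mu]_(x in `]s, t]) h x.
  move=> st; apply: play_increment => // r /andP[sr rt].
  rewrite /F opprD addrACA subrr add0r primitiveB//.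
  apply: le_trans (le_normr_Rintegral _ _) _ => //; first exact: integrableS f0i.
  rewrite -primitiveB// -primitiveB//.
  rewrite lerD2r -subr_ge0.
  by rewrite primitiveB//; exact: Rintegral_ge0.
have [w wi zetaw] := dominated_increments_primitive hi h0 zetah.
have zetaE s t : s <= t -> zeta t - zeta s = primitive w t - primitive w s.
  by move=> st; rewrite zetaw// primitiveB.
have zetaP : zeta = primitive w \+ cst (zeta 0 - primitive w 0).
  apply/funext => t /=; have [t0|/ltW t0] := leP 0 t.
    by have := zetaE _ _ t0; lra.
  by have := zetaE _ _ t0; lra.
have dzeta : {ae mu, forall t : R, is_derive t 1 zeta (w t)}.
  have := primitive_is_derive wi.
  apply: filterS; first exact: (ae_filter_ringOfSetsType mu).
  by move=> t dw; rewrite zetaP -[w t]addr0; exact: is_deriveD.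
(* By [zetah] the functions [primitive h + zeta] and [primitive h - zeta] are nondecreasing, so
   [h + w] and [h - w] are nonnegative wherever they are the derivatives. *)
have w_le : {ae mu, forall t, `|w t| <= h t}.
  have := primitive_is_derive hi; move: dzeta.
  apply: filterS2; first exact: (ae_filter_ringOfSetsType mu).
  move=> t dz dh; rewrite ler_norml; apply/andP; split.
    rewrite -subr_ge0 opprK addrC; apply: is_derive_ge0 (is_deriveD dh dz) _.
    near=> s; have ts : t <= s by apply: ltW; near: s; exact: nbhs_right_gt.
    have := zetah _ _ ts; rewrite -primitiveB// ler_norml !fctE => /andP[+ _].
    lra.
  rewrite -subr_ge0; apply: is_derive_ge0 (is_deriveB dh dz) _.
  near=> s; have ts : t <= s by apply: ltW; near: s; exact: nbhs_right_gt.
  have := zetah _ _ ts; rewrite -primitiveB// ler_norml !fctE => /andP[_ +].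
  lra.
have wL2 : L2 T w.
  apply: Lfun2_dominated fL2.
    have /measurable_int/measurable_EFinP mw := wi.
    exact: (measurable_restrictT _ _).1 (measurable_funTS mw).
  apply: filterS w_le => t.
  by rewrite /h /f0 !patchE; case: ifP => // _; rewrite !normr0.
pose y t := F t - zeta t; pose v t := f t - w t.
have vL2 : L2 T v by exact: L2B.
have yprim t : 0 < t < T -> y t = xi + primitive (v \_ `]0, T[) t.
  move=> /andP[t0 tT].
  have -> : primitive (v \_ `]0, T[) t = primitive f0 t - primitive (w \_ `]0, T[) t.
    rewrite /primitive -RintegralB//; last 2 first.
    - exact: integrableS f0i.
    - exact: integrableS (L2_integrable wL2).
    apply: eq_Rintegral => x _; rewrite /f0 !patchE; case: ifP => // _.
    by rewrite subr0.
  have -> : primitive (w \_ `]0, T[) t = zeta t.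
    rewrite -[RHS]subr0 -[X in _ - X]zeta0 zetaw; last exact: ltW.
    rewrite /primitive Rintegral_mkcond [RHS]Rintegral_mkcond.
    apply: eq_Rintegral => x _; rewrite !patchE !mem_setE !in_itv/=.
    have [xt|xt] := leP x t; last by rewrite andbF.
    by rewrite (le_lt_trans xt tT) !andbT.
  by rewrite /y /F addrA.
have yv : is_weak_derivative T y v.
  move=> phi tphi; rewrite -(primitive_weak_derivative xi T_gt0 vL2 tphi).
  apply: eq_Rintegral => t; rewrite inE/= in_itv/= => /andP[t0 tT].
  by rewrite yprim// t0.
have y1 t : -1 <= y t <= 1.
  have := play_ge F t; have := play_le F t; rewrite /y -/zeta => ? ?.
  by apply/andP; split; lra.
have cy : continuous y.
  rewrite /y zetaP => t; apply: cvgB; first exact: cF.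
  by apply: cvgD; [exact: continuous_primitive|exact: cvg_cst].
have yH1 : H1 T y.
  split; [|exact: continuous_subspaceT|by exists v].
  apply: Lfun2_dominated (Lfun2_indic T).
    have my := continuous_measurable_fun cy.
    exact: (measurable_restrictT _ _).1 (measurable_funTS my).
  apply: aeW => t; rewrite patchE indicE; case: (t \in _); last by rewrite normr0.
  by rewrite normr1 ler_norml.
exists y; split => //; last by rewrite /y zeta0 subr0 F0.
have [ddtL2 ddtw] := ddtP yH1.
have vddt := weak_derivative_unique (continuous_subspaceT cy) vL2 ddtL2 yv ddtw.
have w_sub : {ae mu, forall t, 0 < t < T -> subdiff_ind (y t) (w t)}.
  move: dzeta; apply: filterS; first exact: (ae_filter_ringOfSetsType mu).
  move=> t dz t0T; apply: subdiff_ind_intro => [//|yt|yt].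
    (* [y t > -1] means that [zeta t] is strictly below [F t + 1]; by continuity it stays below
       [F + 1] for a while, so the play cannot be pushed down ([play_lower_bound] with
       [m = zeta t]). The case [y t < 1] is symmetric, with the lower threshold. *)
    have r0 : 0 < y t + 1 by lra.
    have /cvgrPdist_lt/(_ _ r0)[/= del del0 Fdel] := cF t.
    apply: is_derive_ge0 dz _; near=> s.
    have ts : t <= s by apply: ltW; near: s; exact: nbhs_right_gt.
    have sdel : s < t + del by near: s; apply: nbhs_right_lt; rewrite ltrDl.
    apply: play_lower_bound ts _ _ => // r /andP[tr rs].
    have : `|F t - F r| < y t + 1.
      by apply: Fdel; rewrite /= ler0_norm; lra.
    by rewrite ltr_norml => /andP[_]; rewrite /y /zeta; lra.
  have r0 : 0 < 1 - y t by lra.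
  have /cvgrPdist_lt/(_ _ r0)[/= del del0 Fdel] := cF t.
  rewrite -oppr_ge0; apply: is_derive_ge0 (is_deriveN dz) _; near=> s.
  have ts : t <= s by apply: ltW; near: s; exact: nbhs_right_gt.
  have sdel : s < t + del by near: s; apply: nbhs_right_lt; rewrite ltrDl.
  rewrite !fctE lerN2; apply: play_upper_bound ts _ _ => // r /andP[tr rs].
  have : `|F t - F r| < 1 - y t.
    by apply: Fdel; rewrite /= ler0_norm; lra.
  by rewrite ltr_norml => /andP[+ _]; rewrite /y /zeta; lra.
move: vddt w_sub; apply: filterS2; first exact: (ae_filter_ringOfSetsType mu).
move=> t vd ws t0T; exists (w t); first exact: ws.
by rewrite -vd// /v subrK.
Unshelve. all: by end_near. Qed.

Lemma solution_gap_nonincreasing y z a b : sol y -> sol z ->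
  0 < a -> a <= b -> b < T -> (forall s, a <= s <= b -> y s < z s) ->
  z b - y b <= z a - y a.
Proof.
move=> [yH y_sol _] [zH z_sol _] a0 ab bT yz.
have [_ cy _] := yH; have [_ cz _] := zH.
have [dyL2 dyw] := ddtP yH; have [dzL2 dzw] := ddtP zH.
have dyi := L2_integrable dyL2; have dzi := L2_integrable dzL2.
have yE := etrans (weak_derivative_increment cy dyL2 dyw a0 ab bT)
  (primitiveB dyi ab).
have zE := etrans (weak_derivative_increment cz dzL2 dzw a0 ab bT)
  (primitiveB dzi ab).
suff : z b - z a <= y b - y a by move=> {yE zE}; lra.
rewrite zE yE {yE zE}; apply: ae_le_Rintegral => //.
- exact: integrableS dzi.
- exact: integrableS dyi.
move: y_sol z_sol; apply: filterS2; first exact: (ae_filter_ringOfSetsType mu).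
move=> t ysol zsol; rewrite /= in_itv/= => /andP[at_ tb].
have t0T : 0 < t < T by rewrite (lt_trans a0)// (le_lt_trans tb).
have [p py pE] := ysol t0T; have [q qz qE] := zsol t0T.
have tin : `]0, T[%classic t by rewrite /= in_itv.
rewrite !patchE mem_set//.
have ytzt : y t < z t by apply: yz; rewrite ltW.
have := subdiff_ind_monotone py qz ytzt.
(* The term [g_rho] is common to both inclusions, so [dz - dy = p - q]. *)
move: pE qE => /=; move: (ddt T y t) (ddt T z t) => dy dz <-; lra.
Qed.

(** The gap [e = z - y] starts at 0. After the supremum [s0] of its nonpositive times before [t1] it
    is positive, hence cannot increase, so just after [s0] it would already be at least [e t1],
    against continuity. *)
Lemma solution_le y z t : sol y -> sol z -> 0 <= t <= T -> z t <= y t.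
Proof.
move=> ysol zsol t0T; rewrite leNgt; apply/negP => yzt.
have [[_ cy _] _ y0] := ysol; have [[_ cz _] _ z0] := zsol.
pose e s := z s - y s.
have ce : {within `[0, T], continuous e} by move=> s; apply: cvgB; [exact: cz|exact: cy].
have et : 0 < e t by rewrite subr_gt0.
have e0 : e 0 = 0 by rewrite /e z0 y0 subrr.
(* The gap estimate holds at interior times only, so [t = T] is replaced by a slightly earlier
   time. *)
have [t1 [t10 t1T et1]] : exists t1, [/\ 0 < t1, t1 < T & 0 < e t1].
  have [t0 tT] := andP t0T.
  have tgt0 : 0 < t.
    by rewrite lt_neqAle t0 andbT; apply/eqP => t0E; move: et; rewrite -t0E e0 ltxx.
  have [tltT|Tlet] := ltP t T; first by exists t.
  have tE : t = T by apply/le_anti; rewrite tT.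
  have [del del0 edel] := within_continuousP ce t0T et.
  have [m [m0 mT mdel]] : exists m, [/\ 0 < m, m <= T & m <= del].
    by exists (Num.min T del); rewrite lt_min T_gt0 del0 !ge_min !lexx orbT.
  exists (t - m / 2); split; [lra|lra|].
  have : `|e t - e (t - m / 2)| < e t.
    apply: edel; first by apply/andP; split; lra.
    by rewrite opprB addrC subrK gtr0_norm; lra.
  by rewrite ltr_norml => /andP[_]; lra.
pose A := [set s | 0 <= s <= t1 /\ e s <= 0].
have A0 : A 0 by split; [rewrite lexx ltW|rewrite e0].
have supA : has_sup A by split; [exists 0|exists t1 => s [/andP[]]].
pose s0 := sup A.
have s0t1 : s0 <= t1 by apply: ge_sup; [exists 0|move=> s [/andP[]]].
have s00 : 0 <= s0 by exact: (sup_upper_bound supA).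
have gt_s0 s : s0 < s -> s <= t1 -> 0 < e s.
  move=> s0s st1; rewrite ltNge; apply/negP => es.
  have : A s by split=> //; rewrite st1 andbT (le_trans s00)// ltW.
  by move/(sup_upper_bound supA); rewrite leNgt s0s.
(* The tolerance [e t1 / 2] is spent twice, between [s0] and a point [s] with [e s <= 0], and
   between [s0] and [a]; together this gives [e a < e t1]. *)
have m20 : 0 < e t1 / 2 by rewrite divr_gt0.
have s0T : 0 <= s0 <= T by apply/andP; split; lra.
have [del del0 edel] := within_continuousP ce s0T m20.
have [s [/andP[sge0 st1] es] s0s] := sup_adherent del0 supA.
have ss0 : s <= s0 by apply: (sup_upper_bound supA); split=> //; rewrite sge0.
have : `|e s0 - e s| < e t1 / 2.
  apply: edel; first by apply/andP; split; lra.
  by rewrite ger0_norm ?subr_ge0//; rewrite -/s0 in s0s; lra.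
(* The gap estimate needs an interior starting point while [s0] may be 0, so it starts from
   [s0 + del / 2]; if [t1] is itself within [del] of [s0], the choice [a = t1] needs no estimate. *)
have [a [a0 aT as0 ea]] : exists a, [/\ 0 <= a, a <= T, `|s0 - a| < del & e t1 <= e a].
  have [t1s0|s0t1'] := ltP t1 (s0 + del).
    by exists t1; split; [lra|lra|rewrite ler0_norm; lra|].
  exists (s0 + del / 2); split; [lra|lra|rewrite ler0_norm; lra|].
  apply: solution_gap_nonincreasing => //; [lra|lra|].
  move=> r /andP[ar rt1]; rewrite -subr_gt0; apply: gt_s0 => //; lra.
have := edel a; rewrite a0 aT => /(_ isT as0).
rewrite !ltr_norml => /andP[h1 _] /andP[_ h2]; lra.
Qed.
End fixed_data.
End existence_uniqueness.

Theorem theorem2p1 (R : realType) (T k rho1 rho2 : R) (u : R -> R)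
    (T_gt0 : 0 < T) (k_gt0 : 0 < k) (rho12 : rho1 < rho2) (uL2 : L2 T u)
    (xi : R) (xi1 : -1 <= xi <= 1) :
  (exists y : R -> R,
      solution T k rho1 rho2 u xi y /\
      forall z : R -> R, solution T k rho1 rho2 u xi z ->
        forall t : R, 0 <= t <= T -> z t = y t) /\
  (forall y : R -> R, solution T k rho1 rho2 u xi y ->
      let q := fun t : R =>
        - ddt T y t - k * neg_part (u t - rho1) + k * pos_part (u t - rho2) in
      L2 T q /\
      {ae @lebesgue_measure R, forall t, 0 < t < T -> subdiff_ind (y t) (q t)}).
Proof.
split.
  have [y ysol] := solution_exists k rho1 rho2 T_gt0 uL2 xi1.
  exists y; split=> // z zsol t t0T; apply/le_anti/andP; split.
    exact: (solution_le T_gt0 ysol zsol t0T).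
  exact: (solution_le T_gt0 zsol ysol t0T).
move=> y [yH y_sol _] q; have [ddtL2 _] := ddtP yH.
have qE : q = (fun t => g_rho k rho1 rho2 (u t) - ddt T y t).
  by apply/funext => t; rewrite /q /g_rho; lra.
split; first by rewrite qE; exact: L2B (L2_g_rho k rho1 rho2 uL2) ddtL2.
move: y_sol; apply: filterS; first exact: (ae_filter_ringOfSetsType (@lebesgue_measure R)).
move=> t ysol t0T; by have [p py pE] := ysol t0T; rewrite qE -pE addrC addKr.
Qed.
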